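(* Let $(\mathfrak g_0,B_0,(\rho,V))$ be a fundamental triplet over $\mathbb C$. 1) The local Lie algebra $\Gamma(\mathfrak g_0,B_0,\rho)$ (respectively, the minimal graded Lie algebra $\mathfrak g_{min}(\Gamma(\mathfrak g_0,B_0,\rho))$) is transitive if and only if $(\rho,V)$ is faithful, $\langle\mathfrak g_0.V\rangle=V$ and $\langle\mathfrak g_0.V^*\rangle=V^*$. 2) If the representation $(\rho,V)$ is completely reducible, then the local Lie algebra $\Gamma(\mathfrak g_0,B_0,\rho)$ (respectively, the minimal graded Lie algebra $\mathfrak g_{min}(\Gamma(\mathfrak g_0,B_0,\rho))$) is transitive if and only if $(\rho,V)$ is faithful and $V$ does not contain the trivial module.
   Context: All vector spaces and Lie algebras are over $\mathbb C$. A quadratic Lie algebra is a pair $(\mathfrak g_0,B_0)$ where $\mathfrak g_0$ is a finite-dimensional Lie algebra and $B_0$ is a non-degenerate invariant symmetric bilinear form on $\mathfrak g_0$. A fundamental triplet $(\mathfrak g_0,B_0,(\rho,V))$ consists of a quadratic Lie algebra and a finite-dimensional representation $(\rho,V)$ of $\mathfrak g_0$; $(\rho^*,V^* )$ is the contragredient representation. $\langle\mathfrak g_0.V\rangle$ (resp. $\langle\mathfrak g_0.V^*\rangle$) is the subspace generated by all $\rho(U)X$ (resp. $\rho^*(U)Y$), $U\in\mathfrak g_0$, $X\in V$, $Y\in V^*$. A graded Lie algebra is a Lie algebra $\mathfrak g=\bigoplus_{i\in\mathbb Z}\mathfrak g_i$ with $\dim\mathfrak g_i<\infty$, $[\mathfrak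 g_i,\mathfrak g_j]\subset\mathfrak g_{i+j}$, generated by its local part $\mathfrak g_{-1}\oplus\mathfrak g_0\oplus\mathfrak g_1$. A local Lie algebra is a direct sum $\Gamma=\mathfrak g_{-1}\oplus\mathfrak g_0\oplus\mathfrak g_1$ of finite-dimensional spaces with bilinear anticommutative brackets $\mathfrak g_i\times\mathfrak g_j\to\mathfrak g_{i+j}$ for $i,j\in\{-1,0,1\}$ with $|i+j|\le1$, such that the Jacobi identity holds each time its three terms are defined. Morphisms are degree-preserving linear maps compatible with all (defined) brackets. By a theorem of Kac, for every local Lie algebra $\Gamma$ there is a unique graded Lie algebra $\mathfrak g_{max}(\Gamma)$ with local part $\Gamma$ such that every morphism of local Lie algebras from $\Gamma$ to the local part of a graded Lie algebra extends uniquely to a morphism of graded Lie algebras on $\mathfrak g_{max}(\Gamma)$. It has a unique maximal graded ideal $J_{max}$ with $J_{max}\cap\Gamma=\{0\}$, and $\mathfrak g_{min}(\Gamma):=\mathfrak g_{max}(\Gamma)/J_{max}$, with local part $\Gamma$. $\Gamma(\mathfrak g_0,B_0,\rho)=V^*\oplus\mathfrak g_0\oplus V$ (degrees $-1,0,1$) is the local Lie algebra with the bracket of $\mathfrak g_0$, $[U,X]=\rho(U)X$, $[U,Y]=\rho^*(U)Y$, and $[X,Y]\in\mathfrak g_0$ defined by $B_0([X,Y],U)=Y(\rho(U)X)$ for all $U\in\mathfrak g_0$ ($X\in V$, $Y\in V^*$). A graded or local Lie algebra is transitive if: for $x\in\mathfrak g_i$ with $i\ge0$, $[x,\mathfrak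 g_{-1}]=\{0\}$ implies $x=0$; and for $x\in\mathfrak g_i$ with $i\le0$, $[x,\mathfrak g_1]=\{0\}$ implies $x=0$. *)

(* Defs.v *)
From HB Require Import structures.
From mathcomp Require Import all_boot all_order all_algebra.
From mathcomp Require Import sesquilinear.
From mathcomp Require Import all_classical reals.
From mathcomp Require Import complex.

Set Implicit Arguments.
Unset Strict Implicit.
Unset Printing Implicit Defensive.

Import GRing.Theory.
Local Open Scope ring_scope.

Notation is_bilinear f := (bilinear_for *:%R *:%R f).

HB.mixin Record isLieAlgebra (F : fieldType) L of GRing.Lmodule F L := {
  lie : L -> L -> L;
  lie_bilinear : is_bilinear lie;
  liexx : forall x, lie x x = 0;
  lie_jacobi : forall x y z,
    lie x (lie y z) + lie y (lie z x) + lie z (lie x y) = 0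
}.

#[short(type="lieAlgType")]
HB.structure Definition LieAlgebra (F : fieldType) :=
  { L of GRing.Lmodule F L & isLieAlgebra F L }.

#[short(type="finLieAlgType")]
HB.structure Definition FinLieAlgebra (F : fieldType) :=
  { L of Vector F L & isLieAlgebra F L }.

Notation "[| x , y |]" := (lie x y) (format "[| x ,  y |]") : ring_scope.

Section LieTheory.
Variables (F : fieldType) (L : lieAlgType F).
Implicit Types x y z : L.

Lemma lieDl x y z : [|x + y, z|] = [|x, z|] + [|y, z|].
Proof. by have := (lie_bilinear (s := L)).1 z 1 x y; rewrite /= !scale1r. Qed.

Lemma lieDr x y z : [|z, x + y|] = [|z, x|] + [|z, y|].
Proof. by have := (lie_bilinear (s := L)).2 z 1 x y; rewrite /= !scale1r. Qed.

Lemma lieC x y : [|x, y|] = - [|y, x|].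
Proof.
apply/eqP; rewrite -addr_eq0; apply/eqP.
by have := liexx (x + y); rewrite lieDl !lieDr !liexx add0r addr0.
Qed.

End LieTheory.

Record quadraticLie (F : fieldType) := QuadraticLie {
  qlie :> finLieAlgType F;
  qform : {biscalar qlie};
  qform_sym : forall x y, qform x y = qform y x;
  qform_inv : forall x y z, qform [|x, y|] z = qform x [|y, z|];
  qform_nondeg : forall x, (forall y, qform x y = 0) -> x = 0
}.

Record lieRep (F : fieldType) (g : lieAlgType F) (V : vectType F) := LieRep {
  rep :> {linear g -> 'End(V)};
  rep_lie : forall a b x,
    rep [|a, b|] x = rep a (rep b x) - rep b (rep a x)
}.

Section Contragredient.
Variables (F : fieldType) (g : lieAlgType F) (V : vectType F).
Variable rho : lieRep g V.

Definition contra_act (u : g) (y : 'Hom(V, F^o)) : 'Hom(V, F^o) :=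
  - (y \o rho u)%VF.

Lemma contra_actE u y x : contra_act u y x = - y (rho u x).
Proof. by rewrite opp_lfunE comp_lfunE. Qed.

Fact contra_act_linear u : linear (contra_act u).
Proof.
move=> a y z; apply/lfunP => x.
by rewrite add_lfunE scale_lfunE !contra_actE add_lfunE scale_lfunE opprD scalerN.
Qed.
HB.instance Definition _ u := GRing.isLinear.Build F 'Hom(V, F^o) 'Hom(V, F^o) _
  (contra_act u) (contra_act_linear u).

Definition contra_fun (u : g) : 'End('Hom(V, F^o)) := linfun (contra_act u).

Lemma contra_funE u (y : 'Hom(V, F^o)) x : contra_fun u y x = - y (rho u x).
Proof. by rewrite lfunE /= contra_actE. Qed.

Fact contra_fun_linear : linear contra_fun.
Proof.
move=> a u v; apply/lfunP => y; apply/lfunP => x.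
rewrite add_lfunE scale_lfunE add_lfunE scale_lfunE !contra_funE.
by rewrite linearP add_lfunE scale_lfunE linearP opprD scalerN.
Qed.
HB.instance Definition _ := GRing.isLinear.Build F g 'End('Hom(V, F^o)) _
  contra_fun contra_fun_linear.

Fact contra_fun_lie a b (y : 'Hom(V, F^o)) :
  contra_fun [|a, b|] y = contra_fun a (contra_fun b y) - contra_fun b (contra_fun a y).
Proof.
apply/lfunP => x.
rewrite add_lfunE opp_lfunE !contra_funE rep_lie linearB !opprK opprB.
by [].
Qed.

Definition contragredient : lieRep g 'Hom(V, F^o) := LieRep contra_fun_lie.

End Contragredient.

Section RepresentationProperties.
Variables (F : fieldType) (g : finLieAlgType F) (V : vectType F).
Variable rho : lieRep g V.

Definition faithful := injective rho.

Definition action_span : {vspace V} :=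
  <<[seq rho u x | u <- vbasis {:g}, x <- vbasis {:V}]>>%VS.

(* [action_span] does not depend on the chosen bases: it is the smallest
   subspace containing all the rho(u)x. *)
Lemma action_spanP (W : {vspace V}) :
  reflect (forall u x, rho u x \in W) (action_span <= W)%VS.
Proof.
apply: (iffP idP) => [sW u x | sW].
  apply: (subvP sW).
  rewrite (coord_vbasis (memvf u)) (coord_vbasis (memvf x)).
  rewrite !linear_sum /=; apply: memv_suml => j _.
  rewrite sum_lfunE; apply: memv_suml => i _.
  rewrite linearZ /= linearZ /= scale_lfunE !memvZ // memv_span //.
  by apply/allpairsP; exists ((vbasis {:g})`_i, (vbasis {:V})`_j);
     rewrite /= !mem_nth ?size_tuple.
by apply/span_subvP => _ /allpairsP[[u x] /= [_ _ ->]].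
Qed.

Definition submodule (W : {vspace V}) :=
  forall u x, x \in W -> rho u x \in W.

Definition irreducible_submodule (W : {vspace V}) :=
  [/\ submodule W, W != 0%VS &
      forall W' : {vspace V}, submodule W' -> (W' <= W)%VS ->
        W' = 0%VS \/ W' = W].

Definition completely_reducible := exists (n : nat) (W : 'I_n -> {vspace V}),
  [/\ forall i, irreducible_submodule (W i), directv (\sum_i W i) &
      (\sum_i W i)%VS = fullv].

Definition contains_trivial := exists W : {vspace V},
  \dim W = 1%N /\ forall u x, x \in W -> rho u x = 0.

End RepresentationProperties.

(* A local Lie algebra, given by its components of degree -1, 0, 1.  By
   anticommutativity the brackets listed (degrees (0,0), (0,1), (0,-1), (1,-1))
   determine the remaining ones (1,0), (-1,0), (-1,1); the Jacobi identities are
   those for the degrees (0,0,0), (0,0,1), (0,0,-1), (0,1,-1), which are up to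
   order the only ones where all three terms are defined. *)
Record localLie (F : fieldType) := LocalLie {
  loc0 : vectType F;
  locP : vectType F;
  locM : vectType F;
  br00 : loc0 -> loc0 -> loc0;
  br0P : loc0 -> locP -> locP;
  br0M : loc0 -> locM -> locM;
  brPM : locP -> locM -> loc0;
  br00_bilinear : is_bilinear br00;
  br0P_bilinear : is_bilinear br0P;
  br0M_bilinear : is_bilinear br0M;
  brPM_bilinear : is_bilinear brPM;
  br00_alt : forall u, br00 u u = 0;
  jacobi000 : forall u v w,
    br00 u (br00 v w) + br00 v (br00 w u) + br00 w (br00 u v) = 0;
  (* [u, [v, x]] + [v, [x, u]] + [x, [u, v]] = 0 *)
  jacobi00P : forall u v x,
    br0P u (br0P v x) - br0P v (br0P u x) - br0P (br00 u v) x = 0;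
  jacobi00M : forall u v y,
    br0M u (br0M v y) - br0M v (br0M u y) - br0M (br00 u v) y = 0;
  (* [u, [x, y]] + [x, [y, u]] + [y, [u, x]] = 0 *)
  jacobi0PM : forall u x y,
    br00 u (brPM x y) - brPM x (br0M u y) - brPM (br0P u x) y = 0
}.

Definition local_transitive (F : fieldType) (G : localLie F) :=
  [/\ forall u : loc0 G, (forall y, br0M u y = 0) -> u = 0,
      forall x : locP G, (forall y, brPM x y = 0) -> x = 0,
      forall u : loc0 G, (forall x, br0P u x = 0) -> u = 0 &
      forall y : locM G, (forall x, brPM x y = 0) -> y = 0].

Section AssociatedLocalLie.
Variables (F : fieldType) (g : quadraticLie F) (V : vectType F).
Variable rho : lieRep g V.

Definition form_dual_fun (u : g) : 'Hom(g, F^o) :=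
  linfun (qform g u : g -> F^o).

Lemma form_dual_funE u v : form_dual_fun u v = qform g u v.
Proof. by rewrite lfunE. Qed.

Fact form_dual_linear : linear form_dual_fun.
Proof.
move=> a u v; apply/lfunP => w.
by rewrite add_lfunE scale_lfunE !form_dual_funE linearPl.
Qed.
HB.instance Definition _ := GRing.isLinear.Build F g 'Hom(g, F^o) _
  form_dual_fun form_dual_linear.

Definition form_dual : 'Hom(g, 'Hom(g, F^o)) := linfun form_dual_fun.

Definition pairing_fun (x : V) (y : 'Hom(V, F^o)) (u : g) : F^o := y (rho u x).

Fact pairing_linear x y : linear (pairing_fun x y).
Proof.
move=> a u v.
by rewrite /pairing_fun linearP add_lfunE scale_lfunE linearP.
Qed.
HB.instance Definition _ x y := GRing.isLinear.Build F g F^o _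
  (pairing_fun x y) (pairing_linear x y).

Definition pairing x y : 'Hom(g, F^o) := linfun (pairing_fun x y).

Lemma pairingE x y u : pairing x y u = y (rho u x).
Proof. by rewrite lfunE. Qed.

(* [form_dual], which maps u to B0(u, .), is bijective, so [moment x y] is the
   unique element with B0(moment x y, u) = y(rho(u)x) for all u. *)
Definition moment (x : V) (y : 'Hom(V, F^o)) : g :=
  (form_dual^-1)%VF (pairing x y).

Lemma form_dual_lker0 : lker form_dual == 0%VS.
Proof.
apply/lker0P => u v; rewrite !lfunE /= => e.
apply/eqP; rewrite -subr_eq0; apply/eqP; apply: qform_nondeg => w.
by rewrite linearBl -!form_dual_funE e subrr.
Qed.

Lemma form_dual_limg : limg form_dual = fullv.
Proof.
apply/eqP; rewrite eqEdim subvf /=.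
rewrite limg_dim_eq ?(eqP form_dual_lker0) ?capv0 //.
by rewrite !dimvf /dim /= muln1.
Qed.

Lemma momentP x y u : qform g (moment x y) u = y (rho u x).
Proof.
have /(@limg_lfunVK _ _ _ form_dual) e : pairing x y \in limg form_dual.
  by rewrite form_dual_limg memvf.
by rewrite lfunE /= in e; rewrite -form_dual_funE e pairingE.
Qed.

Lemma qform_eq (u v : g) : (forall w, qform g u w = qform g v w) -> u = v.
Proof.
move=> e; apply/eqP; rewrite -subr_eq0; apply/eqP; apply: qform_nondeg => w.
by rewrite linearBl e subrr.
Qed.

Fact moment_bilinear : is_bilinear moment.
Proof.
split=> [y a x x'|x a y y'] /=; apply: qform_eq => u.
  by rewrite linearPl !momentP linearP linearP.
by rewrite linearPl !momentP add_lfunE scale_lfunE.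
Qed.

Fact act_bilinear (U : vectType F) (r : lieRep g U) :
  is_bilinear (fun (u : g) (x : U) => r u x).
Proof.
split=> [x a u v|u a x y] /=; last by rewrite linearP.
by rewrite linearP add_lfunE scale_lfunE.
Qed.

Fact act_jacobi (U : vectType F) (r : lieRep g U) (u v : g) (x : U) :
  r u (r v x) - r v (r u x) - r [|u, v|] x = 0.
Proof. by rewrite rep_lie subrr. Qed.

Fact moment_jacobi (u : g) (x : V) (y : 'Hom(V, F^o)) :
  [|u, moment x y|] - moment x (contragredient rho u y)
    - moment (rho u x) y = 0.
Proof.
apply: qform_eq => w.
rewrite !linearBl linear0l lieC linearNl qform_inv !momentP.
rewrite /= contra_funE rep_lie linearB opprB opprK.
by rewrite addrNK subrr.
Qed.

Definition Gamma : localLie F :=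
  @LocalLie F g V 'Hom(V, F^o) (fun u v => [|u, v|]) (fun u x => rho u x)
    (fun u y => contragredient rho u y) moment
    lie_bilinear (act_bilinear rho) (act_bilinear (contragredient rho))
    moment_bilinear (fun u => liexx u) (fun u v w => lie_jacobi u v w)
    (act_jacobi rho) (act_jacobi (contragredient rho)) moment_jacobi.

End AssociatedLocalLie.

(* Under the classical axioms, the boolean predicates {pred L} used below for
   graded pieces, subspaces and ideals are arbitrary subsets of L. *)
Definition finite_dimensional (F : fieldType) (L : lmodType F) (S : {pred L}) :=
  exists (n : nat) (b : 'I_n -> L),
    forall x, x \in S -> exists c : 'I_n -> F, x = \sum_(i < n) c i *: b i.

Record gradedLie (F : fieldType) := GradedLie {
  grLie :> lieAlgType F;
  piece : int -> {pred grLie};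
  piece_submod : forall i, submod_closed (piece i);
  piece_span : forall x, exists (s : seq int) (c : int -> grLie),
    (forall i, c i \in piece i) /\ x = \sum_(i <- s) c i;
  piece_indep : forall (s : seq int) (c : int -> grLie),
    uniq s -> (forall i, c i \in piece i) -> \sum_(i <- s) c i = 0 ->
    forall i, i \in s -> c i = 0;
  piece_findim : forall i, finite_dimensional (piece i);
  piece_lie : forall i j x y,
    x \in piece i -> y \in piece j -> [|x, y|] \in piece (i + j);
  local_generates : forall S : {pred grLie},
    submod_closed S ->
    {in S &, forall x y, [|x, y|] \in S} ->
    (forall i, i \in [:: -1; 0; 1] -> {subset piece i <= S}) ->
    forall x, x \in S
}.

Arguments piece {F} G i : rename.

Section GradedLie.
Variable F : fieldType.
Implicit Types (Gam : localLie F) (G H : gradedLie F).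

Definition graded_transitive (G : gradedLie F) :=
  (forall (i : int) (x : G), 0 <= i -> x \in piece G i ->
     (forall y, y \in piece G (-1) -> [|x, y|] = 0) -> x = 0) /\
  (forall (i : int) (x : G), i <= 0 -> x \in piece G i ->
     (forall y, y \in piece G 1 -> [|x, y|] = 0) -> x = 0).

Definition graded_morphism (G H : gradedLie F) (f : {linear G -> H}) :=
  (forall i x, x \in piece G i -> f x \in piece H i) /\
  (forall x y, f [|x, y|] = [|f x, f y|]).

(* A morphism of local Lie algebras from Gam to the local part of G. *)
Record localMorphism (Gam : localLie F) (G : gradedLie F) := LocalMorphism {
  mor0 : {linear loc0 Gam -> G};
  morP : {linear locP Gam -> G};
  morM : {linear locM Gam -> G};
  mor0_deg : forall u, mor0 u \in piece G 0;
  morP_deg : forall x, morP x \in piece G 1;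
  morM_deg : forall y, morM y \in piece G (-1);
  mor_br00 : forall u v, mor0 (br00 u v) = [|mor0 u, mor0 v|];
  mor_br0P : forall u x, morP (br0P u x) = [|mor0 u, morP x|];
  mor_br0M : forall u y, morM (br0M u y) = [|mor0 u, morM y|];
  mor_brPM : forall x y, mor0 (brPM x y) = [|morP x, morM y|]
}.

Definition bij_onto (A : Type) (L : lmodType F) (f : A -> L) (S : {pred L}) :=
  injective f /\ forall x, x \in S -> exists a, x = f a.

Definition local_part_iso Gam (G : gradedLie F) (k : localMorphism Gam G) :=
  [/\ bij_onto (mor0 k) (piece G 0), bij_onto (morP k) (piece G 1) &
      bij_onto (morM k) (piece G (-1))].

Definition extends Gam G H (k : localMorphism Gam G)
    (h : localMorphism Gam H) (f : {linear G -> H}) :=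
  [/\ graded_morphism f,
      forall u, f (mor0 k u) = mor0 h u,
      forall x, f (morP k x) = morP h x &
      forall y, f (morM k y) = morM h y].

(* The maximal graded Lie algebra is given by its universal property, which
   determines it up to isomorphism; k identifies Gam with the local part of G. *)
Definition is_gmax Gam (G : gradedLie F) (k : localMorphism Gam G) :=
  local_part_iso k /\
  forall (H : gradedLie F) (h : localMorphism Gam H),
    exists2 f : {linear G -> H}, extends k h f &
      forall f' : {linear G -> H}, extends k h f' -> f' =1 f.

Definition graded_ideal (G : gradedLie F) (J : {pred G}) :=
  [/\ submod_closed J,
      forall x y, y \in J -> [|x, y|] \in J &
      forall x, x \in J -> exists (s : seq int) (c : int -> G),
        (forall i, c i \in piece G i /\ c i \in J) /\ x = \sum_(i <- s) c i].

Definition meets_local_trivially (G : gradedLie F) (J : {pred G}) :=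
  forall a b c, a \in piece G (-1) -> b \in piece G 0 -> c \in piece G 1 ->
    a + b + c \in J -> a + b + c = 0.

Definition is_Jmax (G : gradedLie F) (J : {pred G}) :=
  [/\ graded_ideal J, meets_local_trivially J &
      forall J' : {pred G}, graded_ideal J' -> meets_local_trivially J' ->
        {subset J <= J'} -> {subset J' <= J}].

(* G is the quotient of g_max(Gam) by its maximal graded ideal J with
   J meeting Gam trivially, given by its projection p, a
   surjective morphism with kernel J. *)
Definition is_gmin Gam (G : gradedLie F) :=
  exists (M : gradedLie F) (k : localMorphism Gam M) (J : {pred M})
         (p : {linear M -> G}),
  [/\ is_gmax k, is_Jmax J, graded_morphism p,
      (forall y, exists x, p x = y) &
      (forall x, p x = 0 <-> x \in J)].

End GradedLie.

(* Main.v *)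
Require Import Defs.
From HB Require Import structures.
From mathcomp Require Import all_boot all_order all_algebra.
From mathcomp Require Import all_classical reals.
From mathcomp Require Import complex.
From mathcomp Require Import zify.

Set Implicit Arguments.
Unset Strict Implicit.
Unset Printing Implicit Defensive.

Import GRing.Theory.
Local Open Scope ring_scope.

(** The proof works over an arbitrary field and compares everything with three
    conditions on the representation: faithfulness, absence of nonzero invariant
    vectors in V, and absence of nonzero functionals vanishing on g0.V.

    Local part.  Since B0 is non-degenerate, the bracket [X, Y] of X in V and Y
    in V^* vanishes exactly when Y(rho(U)X) = 0 for all U.  Transitivity of the
    local algebra therefore says: the kernels of rho and of rho^*, which
    coincide, are zero; V has no nonzero invariants; no nonzero Y kills g0.V.
    By duality the last condition means g0.V = V, and, V being its own bidual,
    the absence of invariants means g0.V^* = V^*  ([local_transitiveP]).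

    Minimal algebra.  Brackets of homogeneous elements of degree 0, 1 and -1
    against the local part are those of the local algebra, so only degrees
    |i| >= 2 need an argument.  If x has degree i >= 2 and commutes with g_{-1},
    then so do all its g_0-translates, and closing the space of such elements
    under ad g_1 alone already gives a graded ideal; it lives in degrees >= 2
    and so avoids the local part.  The minimal algebra has no nonzero graded
    ideal of this kind, because its preimage in the maximal algebra would
    enlarge Jmax ([gmin_no_ideal_off_local], [annihilated_eq0]).  Negative
    degrees are symmetric, and the two transitivity properties agree
    ([gmin_transitiveP]).

    Complete reducibility.  For a simple summand W, the submodule formed by the
    intersection of W and g0.V is W or 0; in the latter case g0 kills W.  So
    without invariants every summand lies in g0.V, and g0.V = V comes for free
    ([completely_reducible_span_full]). *)

(** * Duality for finite-dimensional spaces *)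

Section Annihilators.
Variables (F : fieldType) (V : vectType F).

Lemma functionals_separate (x : V) :
  (forall y : 'Hom(V, F^o), y x = 0) -> x = 0.
Proof.
move=> y0; rewrite (coord_vbasis (memvf x)) big1 // => i _.
have := y0 (linfun (coord (vbasis {:V}) i : V -> F^o)).
by rewrite lfunE /= => ->; rewrite scale0r.
Qed.

(** If W were proper, the projection onto a complement of W along W, followed by
    a functional, would be a nonzero functional vanishing on W. *)
Lemma eq_fullv_annihilator (W : {vspace V}) :
  (forall y : 'Hom(V, F^o), (forall x, x \in W -> y x = 0) -> y = 0) ->
  W = fullv.
Proof.
move=> annW; apply/eqP; rewrite eqEsubv subvf /=; apply/subvP => x _.
suff /eqP : daddv_pi W^C W x = 0.
  have dWC : (W^C :&: W = 0)%VS by rewrite capvC capv_compl.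
  have := daddv_pi_add dWC (w := x).
  rewrite addvC addv_complf memvf => /(_ isT) xE /eqP x0.
  by rewrite -xE x0 add0r memv_pi.
apply: functionals_separate => y.
suff /lfunP/(_ x) : (y \o daddv_pi W^C W)%VF = 0 by rewrite comp_lfunE lfunE.
apply: annW => w wW; rewrite comp_lfunE /=.
have dWC : (W :&: W^C = 0)%VS by rewrite capv_compl.
have := daddv_pi_add (U := W^C) (V := W) (w := w).
rewrite capvC dWC addvC addv_complf memvf => /(_ erefl isT).
rewrite (daddv_pi_id dWC wW) -[RHS]add0r => /addIr ->.
by rewrite linear0.
Qed.

(** V is its own bidual: phi is evaluation at the vector whose coordinates are
    the values of phi on the coordinate functionals. *)
Lemma bidual_eval (phi : 'Hom('Hom(V, F^o), F^o)) :
  exists x, forall y, phi y = y x.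
Proof.
pose e := vbasis {:V}.
pose d i : 'Hom(V, F^o) := linfun (coord e i : V -> F^o).
exists (\sum_(i < \dim {:V}) phi (d i) *: e`_i) => y.
have {1}-> : y = \sum_(i < \dim {:V}) y e`_i *: d i.
  apply/lfunP => x; rewrite {1}(coord_vbasis (memvf x)) linear_sum sum_lfunE.
  apply: eq_bigr => i _.
  by rewrite linearZ scale_lfunE lfunE /= [LHS]mulrC.
rewrite !linear_sum; apply: eq_bigr => i _.
by rewrite !linearZ [LHS]mulrC.
Qed.

End Annihilators.

Lemma eq_fullv_annihilator_dual (F : fieldType) (V : vectType F)
    (W : {vspace 'Hom(V, F^o)}) :
  (forall x : V, (forall y : 'Hom(V, F^o), y \in W -> y x = 0) -> x = 0) ->
  W = fullv.
Proof.
move=> annW; apply: eq_fullv_annihilator => phi phiW.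
have [x phiE] := bidual_eval phi; apply/lfunP => y.
rewrite phiE (annW x) ?linear0 ?lfunE // => z zW.
by rewrite -phiE phiW.
Qed.

(** * Invariants, spans and transitivity of the local algebra *)

Section Representations.
Variables (F : fieldType) (g : finLieAlgType F) (V : vectType F).
Variable rho : lieRep g V.

Definition no_invariants := forall x, (forall u, rho u x = 0) -> x = 0.

Lemma faithfulP : faithful rho <-> forall u, (forall x, rho u x = 0) -> u = 0.
Proof.
split=> [inj u u0 | ker0 u v uv].
  by apply: inj; rewrite linear0; apply/lfunP => x; rewrite u0 lfunE.
apply/eqP; rewrite -subr_eq0; apply/eqP/ker0 => x.
by rewrite linearB uv subrr lfunE.
Qed.

Lemma contragredient_kernel u :
  (forall y, contragredient rho u y = 0) <-> (forall x, rho u x = 0).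
Proof.
split=> [u0 x | u0 y].
  apply: functionals_separate => y; apply: oppr_inj.
  by rewrite -(contra_funE rho) [contra_fun rho u y]u0 lfunE oppr0.
by apply/lfunP => x; rewrite /= contra_funE u0 linear0 oppr0 lfunE.
Qed.

Lemma action_span_fullP :
  action_span rho = fullv <->
  forall y : 'Hom(V, F^o), (forall u x, y (rho u x) = 0) -> y = 0.
Proof.
split=> [sp y y0 | ann].
  suff : (action_span rho <= lker y)%VS.
    rewrite sp => /subvP yV; apply/lfunP => x.
    by rewrite lfunE; apply/eqP; rewrite -memv_ker yV ?memvf.
  by apply/action_spanP => u x; rewrite memv_ker y0.
apply: eq_fullv_annihilator => y yW; apply: ann => u x; apply: yW.
exact: (action_spanP rho _ (subvv _)).
Qed.

End Representations.

(** The previous criterion for rho^* quantifies over functionals on V^*, that is,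
    over evaluations at vectors x of V; evaluation at x kills g0.V^* exactly when
    x is invariant. *)
Lemma contragredient_span_fullP (F : fieldType) (g : finLieAlgType F)
    (V : vectType F) (rho : lieRep g V) :
  action_span (contragredient rho) = fullv <-> no_invariants rho.
Proof.
split=> [ |inv0].
  move=> /action_span_fullP sp x x0.
  apply: functionals_separate => y.
  pose ev_fun (z : 'Hom(V, F^o)) : F^o := z x.
  have ev_lin : linear ev_fun.
    by move=> a u v; rewrite /ev_fun add_lfunE scale_lfunE.
  pose ev := linfun (HB.pack_for {linear 'Hom(V, F^o) -> F^o} ev_fun
    (GRing.isLinear.Build F 'Hom(V, F^o) F^o _ ev_fun ev_lin)).
  have evE z : ev z = z x by rewrite lfunE.
  rewrite -evE (sp ev) ?lfunE // => u z.
  by rewrite evE /= contra_funE x0 linear0 oppr0.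
apply/action_span_fullP => phi phi0.
have [x phiE] := bidual_eval phi; apply/lfunP => y.
rewrite phiE (inv0 x) ?linear0 ?lfunE // => u.
apply: functionals_separate => z; apply: oppr_inj.
by rewrite -(contra_funE rho) -phiE [LHS]phi0 oppr0.
Qed.

(** A nonzero invariant vector spans a trivial line, and conversely. *)
Lemma no_trivial_submoduleP (F : fieldType) (g : finLieAlgType F)
    (V : vectType F) (rho : lieRep g V) :
  ~ contains_trivial rho <-> no_invariants rho.
Proof.
split=> [notriv x x0 | inv0 [W [W1 W0]]].
  apply/eqP/negPn/negP => xn0; apply: notriv; exists <[x]>%VS.
  split=> [ |u _ /vlineP[a ->]]; first by rewrite dim_vline xn0.
  by rewrite linearZ /= x0 scaler0.
suff WE : W = 0%VS by move: W1; rewrite WE dimv0.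
apply/eqP; rewrite -subv0; apply/subvP => x xW.
by rewrite memv0; apply/eqP/inv0 => u; apply: W0.
Qed.

(** Each simple summand W meets the submodule g0.V in W or in 0; in the second
    case g0.W, contained in the intersection, is 0 and W consists of invariants. *)
Lemma completely_reducible_span_full (F : fieldType) (g : finLieAlgType F)
    (V : vectType F) (rho : lieRep g V) :
  completely_reducible rho -> no_invariants rho -> action_span rho = fullv.
Proof.
move=> [n [W [irrW _ sumW]]] inv0; apply/eqP.
rewrite eqEsubv subvf -sumW /=; apply/subv_sumP => i _.
have [subW W0 minW] := irrW i.
have rho_span u x : rho u x \in action_span rho.
  exact: (action_spanP rho _ (subvv _)).
have subI : submodule rho (W i :&: action_span rho)%VS.
  by move=> u x; rewrite !memv_cap rho_span andbT => /andP[/subW].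
have [I0 | <-] := minW _ subI (capvSl _ _); last exact: capvSr.
case/eqP: W0; apply/eqP; rewrite -subv0; apply/subvP => x xW.
rewrite memv0; apply/eqP/inv0 => u; apply/eqP; rewrite -memv0 -I0 memv_cap.
by rewrite rho_span subW.
Qed.

(** By non-degeneracy of the form, the bracket of x and y in degree 0 is zero
    exactly when y vanishes on the orbit of x; the two mixed conditions then
    become the annihilator criteria for the two spans. *)
Lemma local_transitiveP (F : fieldType) (g : quadraticLie F)
    (V : vectType F) (rho : lieRep g V) :
  local_transitive (Gamma rho) <->
  [/\ faithful rho, action_span rho = fullv &
      action_span (contragredient rho) = fullv].
Proof.
have moment0 x y : moment rho x y = 0 <-> forall u, y (rho u x) = 0.
  split=> [m0 u | y0]; first by rewrite -momentP m0 linear0l.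
  by apply: qform_nondeg => u; rewrite momentP.
split=> [[/= _ tP t0 tM] | [/faithfulP t0 /action_span_fullP tM]].
  split; first exact/faithfulP.
    by apply/action_span_fullP => y y0; apply: tM => x; apply/moment0.
  apply/contragredient_span_fullP => x x0; apply: tP => y.
  by apply/moment0 => u; rewrite x0 linear0.
move=> /contragredient_span_fullP tP; split=> //=.
- by move=> u /contragredient_kernel/t0.
- move=> x mx0; apply: tP => u; apply: functionals_separate => y.
  by have /moment0 := mx0 y.
by move=> y my0; apply: tM => u x; have /moment0 := my0 x.
Qed.

(** * Homogeneous components in a graded Lie algebra *)

Section Brackets.
Variables (F : fieldType) (L : lieAlgType F).

Fact lie_linear_r (x : L) : linear (lie x).
Proof. by move=> a y z; have := (lie_bilinear (s := L)).2 x a y z. Qed.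
HB.instance Definition _ x := GRing.isLinear.Build F L L _ (lie x)
  (lie_linear_r x).

Lemma lie0r (x : L) : [|0, x|] = 0.
Proof. by rewrite lieC linear0 oppr0. Qed.

Lemma lie_linear_l (a : F) (x y z : L) :
  [|a *: x + y, z|] = a *: [|x, z|] + [|y, z|].
Proof. by have := (lie_bilinear (s := L)).1 z a x y. Qed.

Lemma lie_derivation (x y z : L) :
  [|x, [|y, z|]|] = [|[|x, y|], z|] + [|y, [|x, z|]|].
Proof.
have := lie_jacobi x y z; rewrite (lieC z x) (lieC z) linearN /=.
by move/eqP; rewrite -addrA -opprD subr_eq0 => /eqP ->; rewrite addrC.
Qed.
End Brackets.

Section GradedComponents.
Variables (F : fieldType) (G : gradedLie F).
Implicit Types (i j : int) (x y : G).

Lemma piece0 i : 0 \in piece G i.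
Proof. by have [] := piece_submod G i. Qed.

Lemma pieceP i a x y : x \in piece G i -> y \in piece G i ->
  a *: x + y \in piece G i.
Proof. by have [_ +] := piece_submod G i; apply. Qed.

Lemma pieceZ i a x : x \in piece G i -> a *: x \in piece G i.
Proof. by move=> xi; rewrite -[_ *: _]addr0 pieceP ?piece0. Qed.

(** The family d is required to vanish off the finite set s, so that x determines
    d completely and not just on s. *)
Definition homogeneous_sum x (d : int -> G) :=
  exists2 s : seq int, uniq s &
    [/\ forall i, d i \in piece G i, forall i, i \notin s -> d i = 0 &
        x = \sum_(i <- s) d i].

Lemma homogeneous_sum_ex x : exists d, homogeneous_sum x d.
Proof.
have [s [c [cP ->]]] := piece_span x.
(* The given index sequence may repeat a degree: multiplicities are collected. *)
exists (fun i => c i *+ count_mem i s); exists (undup s).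
  exact: undup_uniq.
split=> [i | i | ].
- by rewrite -scaler_nat pieceZ.
- by rewrite mem_undup => /count_memPn ->.
by rewrite -big_undup_iterop_count.
Qed.

Lemma homogeneous_sum_linear a x y d e :
  homogeneous_sum x d -> homogeneous_sum y e ->
  homogeneous_sum (a *: x + y) (fun i => a *: d i + e i).
Proof.
move=> [s us [dP d0 ->]] [t ut [eP e0 ->]].
(* A sum over s or over t may be extended to the union of the two supports. *)
have ext r (f : int -> G) : uniq r -> (forall i, i \notin r -> f i = 0) ->
    {subset r <= undup (s ++ t)} ->
    \sum_(i <- r) f i = \sum_(i <- undup (s ++ t)) f i.
  move=> ur f0 sub; rewrite [RHS](bigID [in r]) /= [X in _ + X]big1 //.
  rewrite addr0 -[RHS]big_filter; apply: perm_big; apply: uniq_perm => //.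
    by rewrite filter_uniq ?undup_uniq.
  move=> i; rewrite mem_filter; case: (boolP (i \in r)) => //= ir.
  by rewrite sub.
exists (undup (s ++ t)); first exact: undup_uniq.
split=> [i | i | ]; first exact: pieceP.
  rewrite mem_undup mem_cat negb_or => /andP[/d0 -> /e0 ->].
  by rewrite scaler0 addr0.
rewrite big_split -scaler_sumr /= !(ext s, ext t) // => i ir;
  by rewrite mem_undup mem_cat ir ?orbT.
Qed.

Lemma homogeneous_sum0 d : homogeneous_sum 0 d -> d =1 (fun=> 0).
Proof.
move=> [s us [dP d0 /esym sum0]] i.
case: (boolP (i \in s)) => [ |/d0 //]; exact: piece_indep sum0 i.
Qed.

Lemma homogeneous_sum_uniq x d e :
  homogeneous_sum x d -> homogeneous_sum x e -> d =1 e.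
Proof.
move=> xd xe i.
have := homogeneous_sum_linear (-1) xd xe.
rewrite scaleN1r addNr => /homogeneous_sum0/(_ i)/eqP.
by rewrite scaleN1r addrC subr_eq0 => /eqP.
Qed.

Definition component_fun x : int -> G := projT1 (cid (homogeneous_sum_ex x)).

Lemma component_funP x : homogeneous_sum x (component_fun x).
Proof. exact: projT2 (cid _). Qed.

Definition component i x := component_fun x i.

Fact component_linear i : linear (component i).
Proof.
move=> a x y.
apply: (homogeneous_sum_uniq (component_funP _)
  (e := fun i => a *: component_fun x i + component_fun y i)).
exact: homogeneous_sum_linear (component_funP x) (component_funP y).
Qed.
HB.instance Definition _ i := GRing.isLinear.Build F G G _ (component i)
  (component_linear i).

Lemma component_piece i x : component i x \in piece G i.
Proof. by have [s _ [dP _ _]] := component_funP x; apply: dP. Qed.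

Lemma component_sum x : exists s, x = \sum_(i <- s) component i x.
Proof. by have [s _ [_ _ xE]] := component_funP x; exists s. Qed.

Lemma component_homogeneous i j x : x \in piece G i ->
  component j x = if i == j then x else 0.
Proof.
move=> xi.
apply: (homogeneous_sum_uniq (component_funP x)
  (e := fun j => if i == j then x else 0)).
exists [:: i] => //; split=> [k | k | ]; last by rewrite big_seq1 eqxx.
  by case: eqP => [<- // | _]; apply: piece0.
by rewrite inE eq_sym => /negPf ->.
Qed.

Lemma component_id i x : x \in piece G i -> component i x = x.
Proof. by move/component_homogeneous ->; rewrite eqxx. Qed.

Lemma component_lie i j w x : w \in piece G i ->
  component (i + j) [|w, x|] = [|w, component j x|].
Proof.
move=> wi; have [s ->] := component_sum x.
rewrite !linear_sum; apply: eq_bigr => k _ /=.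
have cP := component_piece k x.
rewrite (component_homogeneous _ (piece_lie wi cP)) (component_homogeneous _ cP).
by rewrite (inj_eq (addrI i)); case: eqP => // _; rewrite linear0.
Qed.

(** Stability under the projections is easier to transport along morphisms and
    to prove by induction than the existence of homogeneous expansions. *)
Lemma graded_idealP (J : {pred G}) :
  graded_ideal J <->
  [/\ submod_closed J, forall x y, y \in J -> [|x, y|] \in J &
      forall i x, x \in J -> component i x \in J].
Proof.
split=> -[subJ lieJ grJ]; split=> //.
  move=> i x /grJ [s [c [cP ->]]]; have [J0 JP] := subJ.
  rewrite linear_sum /=.
  elim/big_ind: _ => [//|y z yJ zJ|k _]; first by rewrite -[y]scale1r JP.
  have [cG cJ] := cP k.
  by rewrite (component_homogeneous _ cG); case: eqP.
move=> x xJ; have [s xE] := component_sum x; exists s, (component^~ x).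
by split=> // i; split; [apply: component_piece | apply: grJ].
Qed.

End GradedComponents.

Lemma component_morphism (F : fieldType) (G H : gradedLie F)
    (f : {linear G -> H}) i x :
  graded_morphism f -> component i (f x) = f (component i x).
Proof.
move=> [fdeg _]; have [s ->] := component_sum x.
rewrite !linear_sum; apply: eq_bigr => k _ /=.
have cP := component_piece k x.
rewrite (component_homogeneous _ (fdeg _ _ cP)) (component_homogeneous _ cP).
by case: eqP => // _; rewrite linear0.
Qed.

(** * The minimal graded Lie algebra *)

Definition no_ideal_off_local (F : fieldType) (G : gradedLie F) :=
  forall J : {pred G}, graded_ideal J -> meets_local_trivially J ->
  forall x, x \in J -> x = 0.

(** The preimage in the maximal algebra of such an ideal contains the kernel Jmax
    and still avoids the local part, so maximality makes it equal to Jmax. *)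
Lemma gmin_no_ideal_off_local (F : fieldType) (Gam : localLie F)
    (G : gradedLie F) : is_gmin Gam G -> no_ideal_off_local G.
Proof.
move=> [M [k [J [p [_ [_ J0 Jmax] pmor surj ker]]]]] I Iid I0 x xI.
have [pdeg plie] := pmor.
have [[I_0 IP] lieI grI] := (graded_idealP I).1 Iid.
have [z xE] := surj x; rewrite -xE; apply/ker; rewrite -xE in xI.
apply: (Jmax [pred z | p z \in I]) => //.
- apply/graded_idealP; split.
  + split=> [ | a u v]; rewrite !inE ?linear0 // linearP; exact: IP.
  + by move=> u v; rewrite !inE plie; apply: lieI.
  by move=> i u; rewrite !inE -component_morphism //; apply: grI.
- move=> a b c aM bM cM; rewrite inE !linearD => /I0 abc0; apply: (J0) => //.
  by apply/ker; rewrite !linearD abc0 // pdeg.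
by move=> u /ker; rewrite inE => ->.
Qed.

(** The projection from the maximal algebra is injective on each of the three
    local pieces because Jmax avoids the local part, and maps each piece onto the
    corresponding piece because it commutes with homogeneous components. *)
Lemma gmin_local_part (F : fieldType) (Gam : localLie F) (G : gradedLie F) :
  is_gmin Gam G -> exists h : localMorphism Gam G, local_part_iso h.
Proof.
move=> [M [k [J [p [[[[i0 s0] [iP sP] [iM sM]] _] [_ J0 _] pmor surj ker]]]]].
have [pdeg plie] := pmor.
have p_inj i z : i \in [:: -1; 0; 1] -> z \in piece M i -> p z = 0 -> z = 0.
  move=> iloc zM /ker; have zero j := piece0 M j.
  by move: iloc zM; rewrite !inE => /or3P[] /eqP-> zM zJ;
    [have := J0 _ _ _ zM (zero 0) (zero 1)
    |have := J0 _ _ _ (zero (-1)) zM (zero 1)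
    |have := J0 _ _ _ (zero (-1)) (zero 0) zM];
    rewrite ?addr0 ?add0r; apply.
have p_onto i x : x \in piece G i -> exists2 z, z \in piece M i & x = p z.
  move=> xG; have [z zE] := surj x; exists (component i z).
    exact: component_piece.
  by rewrite -component_morphism // zE component_id.
have bij (A : lmodType F) i (f : {linear A -> M}) : i \in [:: -1; 0; 1] ->
    (forall a, f a \in piece M i) -> injective f ->
    (forall z, z \in piece M i -> exists a, z = f a) ->
    bij_onto (p \o f) (piece G i).
  move=> iloc fdeg finj fsur; split=> [a b /= pab | x /p_onto[z /fsur[a ->] ->]].
    apply: finj; apply/eqP; rewrite -subr_eq0 -linearB; apply/eqP.
    by apply: (p_inj i) => //; rewrite !linearB /= pab subrr.
  by exists a.
have h0 u : (p \o mor0 k) u \in piece G 0 by apply/pdeg/mor0_deg.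
have hP x : (p \o morP k) x \in piece G 1 by apply/pdeg/morP_deg.
have hM y : (p \o morM k) y \in piece G (-1) by apply/pdeg/morM_deg.
unshelve eexists (@LocalMorphism F Gam G (p \o mor0 k) (p \o morP k)
  (p \o morM k) h0 hP hM _ _ _ _).
- by move=> u v /=; rewrite mor_br00 plie.
- by move=> u v /=; rewrite mor_br0P plie.
- by move=> u v /=; rewrite mor_br0M plie.
- by move=> u v /=; rewrite mor_brPM plie.
split; apply: bij => //.
- exact: mor0_deg.
- exact: morP_deg.
exact: morM_deg.
Qed.

(** * Elements annihilated by a local piece generate ideals off the local part *)

Section AnnihilatedIdeal.
Variables (F : fieldType) (G : gradedLie F) (e : int).
Hypothesis e_unit : e = 1 \/ e = -1.

(** The sign e treats positive and negative degrees together: the generators are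
    the elements of degree i with e * i >= 2 that commute with the piece of degree
    - e.  Only closure under ad of the piece of degree e is imposed; closure under
    the rest of G is a consequence, which keeps the degrees under control. *)
Inductive annihilated_ideal : G -> Prop :=
| AnnGen i x : 2 <= e * i -> x \in piece G i ->
    (forall y, y \in piece G (- e) -> [|x, y|] = 0) -> annihilated_ideal x
| Ann0 : annihilated_ideal 0
| AnnLin a x y : annihilated_ideal x -> annihilated_ideal y ->
    annihilated_ideal (a *: x + y)
| AnnLie w x : w \in piece G e -> annihilated_ideal x ->
    annihilated_ideal [|w, x|].

Local Notation I := annihilated_ideal.

Lemma annihilated_ideal_add x y : I x -> I y -> I (x + y).
Proof. by move=> Ix Iy; rewrite -[x]scale1r; apply: AnnLin. Qed.

(** The generators are stable under degree 0, since [v, [u, x]] is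
    [[v, u], x] + [u, [v, x]] with v and [v, u] both of degree - e; the derivation
    rule carries this through brackets by the piece of degree e. *)
Lemma annihilated_ideal_lie0 u x : u \in piece G 0 -> I x -> I [|u, x|].
Proof.
move=> u0; elim=> {x} [i x ei xi x0 | | a x y _ IHx _ IHy | w x we Ix IHx].
- apply: (AnnGen ei); first by rewrite -(add0r i) piece_lie.
  move=> y ye; rewrite lieC lie_derivation (lieC y x) (x0 y) // oppr0 linear0.
  rewrite addr0 lieC x0 ?oppr0 ?oppr0 //.
  by rewrite -[X in piece G X]addr0 piece_lie.
- by rewrite linear0; apply: Ann0.
- by rewrite linearP; apply: AnnLin.
rewrite lie_derivation; apply: annihilated_ideal_add; last exact: AnnLie.
by apply: AnnLie => //; rewrite -[e]add0r piece_lie.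
Qed.

(** In [v, [w, x]] = [[v, w], x] + [w, [v, x]], the element [v, w] has degree 0. *)
Lemma annihilated_ideal_lieN v x : v \in piece G (- e) -> I x -> I [|v, x|].
Proof.
move=> ve; elim=> {x} [i x ei xi x0 | | a x y _ IHx _ IHy | w x we Ix IHx].
- by rewrite lieC x0 // oppr0; apply: Ann0.
- by rewrite linear0; apply: Ann0.
- by rewrite linearP; apply: AnnLin.
rewrite lie_derivation; apply: annihilated_ideal_add; last exact: AnnLie.
by apply: annihilated_ideal_lie0 => //; have := piece_lie ve we; rewrite addNr.
Qed.

(** The elements z whose ad preserves the ideal form a subalgebra; it contains the
    local part, which generates G. *)
Lemma annihilated_ideal_lie z x : I x -> I [|z, x|].
Proof.
pose S : {pred G} := [pred z | `[< forall x, I x -> I [|z, x|] >]].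
have SP y : y \in S <-> forall x, I x -> I [|y, x|].
  by split=> [/asboolP|?] //; apply/asboolP.
suff /SP : z \in S by apply.
apply: local_generates; [split=> [ | a u v /SP uS /SP vS] | | ].
- by apply/SP => y _; rewrite lie0r; apply: Ann0.
- apply/SP => y Iy; rewrite lie_linear_l; apply: AnnLin; [exact: uS | exact: vS].
- move=> u v /SP uS /SP vS; apply/SP => y Iy.
  rewrite -[X in I X](addrK [|v, [|u, y|]|]) -lie_derivation.
  rewrite addrC -scaleN1r; apply: AnnLin; [apply: vS|apply: uS]; auto.
move=> i iloc u ui; apply/SP => y.
have: i \in [:: -e; 0; e] by case: e_unit iloc => ->; rewrite !inE; lia.
rewrite !inE => /or3P[] /eqP iE; rewrite iE in ui.
- exact: annihilated_ideal_lieN.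
- exact: annihilated_ideal_lie0.
exact: AnnLie.
Qed.

Lemma annihilated_ideal_component j x : I x ->
  I (component j x) /\ (e * j < 2 -> component j x = 0).
Proof.
move=> Ix; elim: Ix j => {x} [i x ei xi x0 | | a x y _ IHx _ IHy | w x we Ix IHx] j.
- rewrite (component_homogeneous _ xi); case: eqP => [<-|_].
    by split=> [ |lt]; [exact: AnnGen ei xi x0 | lia].
  by split=> //; apply: Ann0.
- by rewrite linear0; split=> //; apply: Ann0.
- have [Ix x0] := IHx j; have [Iy y0] := IHy j; rewrite linearP /=.
  by split=> [ |lt]; [exact: AnnLin | rewrite x0 // y0 // scaler0 addr0].
have [Ic c0] := IHx (j - e).
have -> : component j [|w, x|] = [|w, component (j - e) x|].
  by rewrite -(component_lie _ _ we) addrCA subrr addr0.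
split=> [ |lt]; first exact: AnnLie.
by rewrite c0 ?linear0 //; case: e_unit lt => ->; lia.
Qed.

(** The ideal generated by x is graded and lives in degrees j with e * j >= 2, so
    it avoids the local part. *)
Lemma annihilated_eq0 i x : no_ideal_off_local G ->
  2 <= e * i -> x \in piece G i ->
  (forall y, y \in piece G (- e) -> [|x, y|] = 0) -> x = 0.
Proof.
move=> minG ei xi x0.
pose J : {pred G} := [pred z | `[< I z >]].
have JP z : z \in J <-> I z by split=> [/asboolP|?] //; apply/asboolP.
apply: (minG J); last by apply/JP; apply: AnnGen ei xi x0.
  apply/graded_idealP; split.
  - split=> [ | a u v /JP Iu /JP Iv]; apply/JP; [exact: Ann0|exact: AnnLin].
  - by move=> u v /JP Iv; apply/JP/annihilated_ideal_lie.
  by move=> j u /JP Iu; apply/JP; have [] := annihilated_ideal_component j Iu.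
move=> a b c aG bG cG /JP Iabc.
have c0 j := (annihilated_ideal_component j Iabc).2.
have comp j : component j (a + b + c) = 
   (if -1 == j then a else 0) + (if 0 == j then b else 0) + (if 1 == j then c else 0).
  by rewrite !linearD /= (component_homogeneous _ aG) (component_homogeneous _ bG)
     (component_homogeneous _ cG).
have [aE bE cE] : [/\ a = 0, b = 0 & c = 0].
  split.
  - by rewrite -(c0 (-1)) ?comp ?addr0 //; case: e_unit => ->.
  - by rewrite -(c0 0) ?comp ?addr0 ?add0r //; case: e_unit => ->.
  by rewrite -(c0 1) ?comp ?addr0 ?add0r //; case: e_unit => ->.
by rewrite aE bE cE !addr0.
Qed.
End AnnihilatedIdeal.

(** * Transitivity of the minimal algebra *)

(** In degrees 0, 1, -1 both conditions are the same through the identification of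
    the local part; in the other degrees minimality alone gives the conclusion. *)
Lemma gmin_transitiveP (F : fieldType) (Gam : localLie F) (G : gradedLie F) :
  is_gmin Gam G -> (graded_transitive G <-> local_transitive Gam).
Proof.
move=> Gmin; have minG := gmin_no_ideal_off_local Gmin.
have [h [[i0 s0] [iP sP] [iM sM]]] := gmin_local_part Gmin.
split=> [[tpos tneg] | [t0M tP t0P tM]].
- split=> [u u0 | x x0 | u u0 | y y0].
  + apply: i0; rewrite linear0; apply: (tpos 0) => // [ |_ /sM[y ->]].
      exact: mor0_deg.
    by rewrite -mor_br0M u0 linear0.
  + apply: iP; rewrite linear0; apply: (tpos 1) => // [ |_ /sM[y ->]].
      exact: morP_deg.
    by rewrite -mor_brPM x0 linear0.
  + apply: i0; rewrite linear0; apply: (tneg 0) => // [ |_ /sP[y ->]].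
      exact: mor0_deg.
    by rewrite -mor_br0P u0 linear0.
  apply: iM; rewrite linear0; apply: (tneg (-1)) => // [ |_ /sP[x ->]].
    exact: morM_deg.
  by rewrite lieC -mor_brPM y0 linear0 oppr0.
split=> i x sgn xi x0.
- have [i0'|[i1|i2]] : i = 0 \/ i = 1 \/ 2 <= 1 * i by lia.
  + rewrite i0' in xi; have [u uE] := s0 _ xi; rewrite uE in x0 *.
    rewrite (t0M u) ?linear0 // => y; apply: iM.
    by rewrite mor_br0M x0 ?linear0 //; apply: morM_deg.
  + rewrite i1 in xi; have [u uE] := sP _ xi; rewrite uE in x0 *.
    rewrite (tP u) ?linear0 // => y; apply: i0.
    by rewrite mor_brPM x0 ?linear0 //; apply: morM_deg.
  by apply: (annihilated_eq0 _ minG i2 xi x0); left.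
have [i0'|[i1|i2]] : i = 0 \/ i = -1 \/ 2 <= -1 * i by lia.
+ rewrite i0' in xi; have [u uE] := s0 _ xi; rewrite uE in x0 *.
  rewrite (t0P u) ?linear0 // => y; apply: iP.
  by rewrite mor_br0P x0 ?linear0 //; apply: morP_deg.
+ rewrite i1 in xi; have [u uE] := sM _ xi; rewrite uE in x0 *.
  rewrite (tM u) ?linear0 // => y; apply: i0.
  rewrite mor_brPM lieC x0 ?linear0 ?oppr0 //; exact: morP_deg.
by apply: (annihilated_eq0 _ minG i2 xi); [right | rewrite opprK].
Qed.

Theorem proposition3p4p3 (R : realType) (g0 : quadraticLie R[i])
    (V : vectType R[i]) (rho : lieRep g0 V) :
  ((local_transitive (Gamma rho) <->
      [/\ faithful rho, action_span rho = fullv &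
          action_span (contragredient rho) = fullv]) /\
   (forall gmin : gradedLie R[i], is_gmin (Gamma rho) gmin ->
      (graded_transitive gmin <->
        [/\ faithful rho, action_span rho = fullv &
            action_span (contragredient rho) = fullv]))) /\
  (completely_reducible rho ->
    (local_transitive (Gamma rho) <->
       faithful rho /\ ~ contains_trivial rho) /\
    (forall gmin : gradedLie R[i], is_gmin (Gamma rho) gmin ->
       (graded_transitive gmin <->
         faithful rho /\ ~ contains_trivial rho))).
Proof.
have loc := local_transitiveP rho.
split; first by split=> // gmin /gmin_transitiveP ->.
move=> cr.
have loc_cr : local_transitive (Gamma rho) <->
    faithful rho /\ ~ contains_trivial rho.
  rewrite loc no_trivial_submoduleP; split=> [[inj _ sp] | [inj inv0]].
    by split=> //; apply/contragredient_span_fullP.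
  split=> //; first exact: completely_reducible_span_full.
  exact/contragredient_span_fullP.
by split=> // gmin /gmin_transitiveP ->.
Qed.
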